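(* Let $n\ge1$. (i) Let $N\ge 1$ and let $q_m\in\{0,1,\dots,N\}$ for $m\in\{1,\dots,n\}$. Let $\mathcal{X}^{(N)}_{\mathbf q}$ be the set of those $x\in\{1,\infty\}^{\mathbb{Z}_N\times\{1,\dots,n\}}$ which have exactly $q_m$ particles on line $m$ (i.e. $\#\{i:x_m(i)=1\}=q_m$) for $m=1,\dots,n$. Then the uniform distribution on $\mathcal{X}^{(N)}_{\mathbf q}$ is a stationary distribution for the multiline process on $\mathbb{Z}_N$ with $n$ lines. (ii) Let $\rho_1,\dots,\rho_n\in[0,1]$. Let $\nu$ be the product distribution on $\{1,\infty\}^{\mathbb{Z}\times\{1,\dots,n\}}$ under which all the $x_m(i)$ are independent and $\mathbb{P}(x_m(i)=1)=\rho_m$. Then $\nu$ is a stationary distribution for the multiline process on $\mathbb{Z}$ with $n$ lines.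
   Context: The multiline process with $n$ lines on $\mathbb{Z}$ (respectively on the cycle $\mathbb{Z}_N$ of integers mod $N$) is a continuous-time Markov process with state space $\{1,\infty\}^{\mathbb{Z}\times\{1,\dots,n\}}$ (respectively $\{1,\infty\}^{\mathbb{Z}_N\times\{1,\dots,n\}}$). For a state $x$, $x_m(i)$ is the value at site $i$ on line $m$; the value $1$ indicates a particle and $\infty$ a hole, with $1<\infty$. For a state $x$ and a site $i$, define $b_m=b_m(x,i)$, $m=0,\dots,n$, by $b_n=i$ and, for $m=n-1,\dots,0$, $b_m=b_{m+1}$ if $x_{m+1}(b_{m+1})=1$ and $b_m=b_{m+1}+1$ if $x_{m+1}(b_{m+1})=\infty$. Let $y=Y(x,i)$ be the state given, for each $m=1,\dots,n$, by $y_m(j)=x_m(j)$ for $j\notin\{b_m-1,b_m\}$, $y_m(b_m-1)=\min\{x_m(b_m-1),x_m(b_m)\}$, $y_m(b_m)=\max\{x_m(b_m-1),x_m(b_m)\}$. Dynamics: bells ring at each site of the bottom line (line $n$) as independent Poisson processes of rate 1; when the bell at site $i$ of line $n$ rings, the state $x$ jumps to $Y(x,i)$ (one says that a bell rings at site $b_m(x,i)$ on line $m$ at that moment). *)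

(* Defs.v *)
From HB Require Import structures.
From mathcomp Require Import all_boot all_order all_algebra.
From mathcomp Require Import finmap.
From mathcomp Require Import all_classical all_reals all_analysis.

Set Implicit Arguments.
Unset Strict Implicit.
Unset Printing Implicit Defensive.

Import Order.TTheory GRing.Theory Num.Theory.
Import numFieldNormedType.Exports.

Local Open Scope classical_set_scope.
Local Open Scope ring_scope.

(* The alphabet {1, oo} is bool, with 1 := false and oo := true, so that the
   library order false < true on bool is the order 1 < oo and Order.min and
   Order.max have their literal meaning. *)
Definition particle : bool := false.
Definition hole : bool := true.

(* A state is x : S * 'I_n -> bool, with x (i, m) the value at site i.  Lines
   are numbered from 0: the ordinal m : 'I_n is the line usually numbered m.+1,
   and the bottom line n is the ordinal n.-1. *)
Definition cylinders (S : Type) (n : nat) : set (set (S * 'I_n -> bool)) :=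
  [set A | exists c v, A = [set x | x c = v]].
Definition config (S : Type) (n : nat) := g_sigma_algebraType (@cylinders S n).

(* The one-dimensional lattice of sites is given by a type S with the maps
   succ : i |-> i + 1 and pred : i |-> i - 1. *)
Section Jumps.
Context (S : eqType) (succ pred : S -> S) (n : nat).

(* bell_site x i m is b_m(x, i), for 0 <= m <= n; see the two lemmas below. *)
Definition bell_site (x : config S n) (i : S) (m : nat) : S :=
  foldr (fun (l : 'I_n) b => if x (b, l) == particle then b else succ b)
        i (drop m (enum 'I_n)).

Lemma bell_site_bottom x i : bell_site x i n = i.
Proof. by rewrite /bell_site drop_oversize // size_enum_ord. Qed.

Lemma bell_site_rec x i (m : 'I_n) :
  bell_site x i m =
    (let b := bell_site x i m.+1 in
     if x (b, m) == particle then b else succ b).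
Proof.
rewrite /bell_site (drop_nth m) ?size_enum_ord //=.
by rewrite nth_ord_enum.
Qed.

Definition jump (x : config S n) (i : S) : config S n :=
  fun c => let: (j, m) := c in
    let b := bell_site x i m.+1 in
    if j == pred b then Order.min (x (pred b, m)) (x (b, m))
    else if j == b then Order.max (x (pred b, m)) (x (b, m))
    else x (j, m).

End Jumps.

Section Process.
Context (R : realType) (S : choiceType) (succ pred : S -> S) (n : nat).

Definition rings (N : R -> nat) (t : R) : Prop :=
  forall s, 0 <= s -> s < t -> (N s < N t)%N.

(* Limits in the product topology on {1, oo}^(S x {1..n}). *)
Definition left_limit (X : R -> config S n) (t : R) (x : config S n) : Prop :=
  forall c, \forall s \near t^'-, X s c = x c.
Definition right_limit (X : R -> config S n) (t : R) (x : config S n) : Prop :=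
  forall c, \forall s \near t^'+, X s c = x c.

(* When S is infinite the set of all ringing times is dense, so the evolution
   cannot be read as a sequence of jumps; but every coordinate has a cadlag
   path, and X t is obtained from X (t-) by the jump of the bell ringing at t,
   if any. *)
Definition follows_bells (N : S -> R -> nat) (X : R -> config S n) : Prop :=
  (forall t, 0 <= t -> right_limit X t (X t)) /\
  (forall t, 0 < t -> exists x, [/\ left_limit X t x,
     forall i, rings (N i) t -> X t = jump succ pred x i &
     (forall i, ~ rings (N i) t) -> X t = x]).

Section OnProbabilitySpace.
Context d (T : measurableType d) (P : probability T R).
Context (F : R -> set (set T)) (N : S -> R -> T -> nat)
        (X : R -> T -> config S n).

Definition filtration : Prop :=
  [/\ forall t, 0 <= t -> sigma_algebra setT (F t),
      forall t, 0 <= t -> F t `<=` measurable &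
      forall s t, 0 <= s -> s <= t -> F s `<=` F t].

(* Independent rate 1 Poisson processes relative to F: on ]s, t] the
   increments of the N i are Poisson of parameter t - s, independent of each
   other and of F s (E ranges over the events of F s, A over the finite sets
   of sites). *)
Definition poisson_bells : Prop :=
  [/\ forall i w, [/\ N i 0 w = 0%N,
        forall s t, 0 <= s -> s <= t -> (N i s w <= N i t w)%N &
        forall t, 0 <= t -> \forall s \near t^'+, N i s w = N i t w],
      forall i t k, 0 <= t -> F t [set w | N i t w = k] &
      forall s t, 0 <= s -> s < t ->
      forall E, F s E -> forall (A : {fset S}) (k : S -> nat),
        P (E `&` \bigcap_(i in [set` A])
                   [set w | N i t w = (N i s w + k i)%N]) =
        (P E * (\prod_(i <- A) poisson_pmf (t - s) (k i))%:E)%E].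

Definition multiline_process : Prop :=
  [/\ filtration, poisson_bells,
      forall t, 0 <= t -> forall B, measurable B -> F t (X t @^-1` B) &
      {ae P, forall w, follows_bells (fun i t => N i t w) (fun t => X t w)}].

End OnProbabilitySpace.

Definition stationary (nu : set (config S n) -> \bar R) : Prop :=
  forall d (T : measurableType d) (P : probability T R)
         (F : R -> set (set T)) (N : S -> R -> T -> nat)
         (X : R -> T -> config S n),
    multiline_process P F N X ->
    (forall B, measurable B -> P (X 0 @^-1` B) = nu B) ->
    forall t, 0 <= t -> forall B, measurable B -> P (X t @^-1` B) = nu B.

End Process.

(* For A finite and nonempty. *)
Definition uniform_on (R : realType) (T : choiceType) (A : set T) :
    set T -> \bar R :=
  fun B => ((#|` fset_set (A `&` B)|)%:R / (#|` fset_set A|)%:R)%:E.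

(* On the cycle Z_N the sites are 'I_N, with the cyclic maps ordS, ord_pred. *)
Definition config_with_counts (n N : nat) (q : 'I_n -> nat) :
    set (config 'I_N n) :=
  [set x | forall m, #|[set i : 'I_N | x (i, m) == particle]%SET| = q m].
Arguments config_with_counts {n} N q.

Definition product_distribution (R : realType) (S : choiceType) (n : nat)
    (rho : 'I_n -> R) (nu : probability (config S n) R) : Prop :=
  (forall i m, nu [set x | x (i, m) = particle] = (rho m)%:E) /\
  (forall (A : {fset S * 'I_n}) (B : S * 'I_n -> set bool),
     nu (\bigcap_(c in [set` A]) [set x | B c (x c)]) =
     (\prod_(c <- A) nu [set x | B c (x c)])%E).

(* Main.v *)
Require Import Defs.
From mathcomp Require Import all_boot all_order all_algebra.
From mathcomp Require Import finmap.
From mathcomp Require Import all_classical all_reals all_analysis.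
From mathcomp Require Import lra ring zify.

(* Generator argument, carried out on events rather than functions. Write J_i
   for the jump of a bell at i and B for an event depending on finitely many
   sites.

   Balance: the measure nu satisfies sum_i (nu (J_i^-1 B) - nu B) = 0, a finite
   sum because J_i^-1 B = B for i far from B. On a finite set of sites, the map
   (x, i) |-> (J_i x, b_0(x, i)) is injective, hence bijective: on each line a
   jump exchanges two neighbouring values or does nothing, and the pair on the
   right tells from the top line downwards which of the two happened. Any weight
   invariant under exchanges within a line is therefore balanced. Product
   measures on Z inherit balance from the cycle, B being seen through a window
   much larger than its support.

   Evolution: looking at the bells that ring in a short interval ]t, t + h]
   near B (none, one, or more with probability O(h^2)) gives
     P(X_(t+h) in B) - P(X_t in B)
       = h sum_i (P(X_t in J_i^-1 B) - P(X_t in B)) + O(h^2).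
   So if X_s has law nu, the discrepancy D_B(u) = P(X_(s+u) in B) - nu B is the
   integral of sum_i (D_(J_i^-1 B) - D_B). Iterating K times from |D| <= 1,
   while the support grows by n + 1 sites at each step, bounds D_B(u) by
   (2 (n+1)^2 u)^K binom(r + K, K), with r proportional to the size of the
   support. This tends to 0 for u below a threshold that does not depend on B,
   so the law stays nu up to that time, and then forever. *)

Set Implicit Arguments.
Unset Strict Implicit.
Unset Printing Implicit Defensive.

Import Order.TTheory GRing.Theory Num.Theory.
Import numFieldNormedType.Exports.

Local Open Scope classical_set_scope.
Local Open Scope ring_scope.

(** * Locality of jumps *)

Section Locality.
Context (S : eqType) (succ pred : S -> S) (n : nat).
Hypotheses (predK : cancel pred succ) (succK : cancel succ pred).

Implicit Types (x y : config S n) (L : seq S) (B : set (config S n)).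

(* The sites read or modified by a bell at i: i - 1, ..., i + n - 1. *)
Definition reach (i : S) : seq S :=
  [seq iter k succ (pred i) | k <- iota 0 n.+1].

(* The sites i such that reach i meets L. *)
Definition bells L : seq S :=
  [seq succ (iter k pred j) | j <- L, k <- iota 0 n.+1].

Lemma size_reach i : size (reach i) = n.+1.
Proof. by rewrite size_map size_iota. Qed.

Lemma size_bells L : size (bells L) = (size L * n.+1)%N.
Proof. by rewrite size_allpairs size_iota. Qed.

Lemma mem_bells L i j : j \in reach i -> j \in L -> i \in bells L.
Proof.
case/mapP => k kn -> jL; apply/allpairsP; exists (iter k succ (pred i), k).
split=> //=; rewrite -{1}(predK i); congr succ.
by elim: k {kn jL} => //= k ih; rewrite -iterS iterSr succK.
Qed.

(** Descending induction on the line, run on the distance d = n - m to the bottom: each line moves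
    the bell at most one site to the right. *)
Lemma bell_site_iter x i m : (m <= n)%N ->
  exists2 k, (k <= n - m)%N & bell_site succ x i m = iter k succ i.
Proof.
move=> mn; rewrite -(subKn mn); move: (leq_subr m n); move: (n - m)%N.
elim=> [|d ih] dn; first by exists 0%N; rewrite // subn0 bell_site_bottom.
have ltdn : (n - d.+1 < n)%N by rewrite ltn_subrL (leq_trans _ dn).
have [k kd Ek] := ih (ltnW dn).
have -> : bell_site succ x i (n - d.+1) = bell_site succ x i (Ordinal ltdn).
  by [].
rewrite bell_site_rec /= -subSn // subSS Ek.
move: kd; rewrite !subKn // ?(ltnW dn)// => kd.
by case: ifP => _; [exists k => //; exact: leqW | exists k.+1].
Qed.

Lemma bell_site_reach x i m : (m < n)%N ->
  bell_site succ x i m.+1 \in reach i /\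
  pred (bell_site succ x i m.+1) \in reach i.
Proof.
move=> mn; have [k kn ->] := bell_site_iter x i mn.
(* Only b_1, ..., b_n are at stake, so k < n. The remaining b_0 can be i + n, outside the reach. *)
have kn1 : (k < n)%N by apply: leq_ltn_trans kn _; rewrite ltn_subrL (leq_trans _ mn).
split; apply/mapP.
  by exists k.+1; rewrite ?mem_iota ?add0n ?ltnS// iterSr predK.
exists k; first by rewrite mem_iota add0n ltnS (ltnW kn1).
by rewrite -{1}(predK i) -iterSr iterS succK.
Qed.

Definition eq_on L x y := forall j m, j \in L -> x (j, m) = y (j, m).

Lemma eq_on_sub L L' x y : {subset L <= L'} -> eq_on L' x y -> eq_on L x y.
Proof. by move=> sL xy j m /sL; exact: xy. Qed.

Lemma eq_on_sym L x y : eq_on L x y -> eq_on L y x.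
Proof. by move=> xy j m jL; rewrite xy. Qed.

Lemma eq_on_trans L x y z : eq_on L x y -> eq_on L y z -> eq_on L x z.
Proof. by move=> xy yz j m jL; rewrite xy// yz. Qed.

Lemma jump_outside x i j m : j \notin reach i -> jump succ pred x i (j, m) = x (j, m).
Proof.
move=> jr; have [br pbr] := bell_site_reach x i (ltn_ord m).
rewrite /jump /=; case: eqP => [jE|_]; first by rewrite jE pbr in jr.
by case: eqP => // jE; rewrite jE br in jr.
Qed.

Lemma jump_eq_on_disjoint L x i : ~~ has [in L] (reach i) ->
  eq_on L (jump succ pred x i) x.
Proof.
move=> /hasPn dis j m jL; apply: jump_outside.
by apply/negP => /dis; rewrite /= jL.
Qed.

Lemma bell_site_eq_on x y i m : eq_on (reach i) x y -> (m <= n)%N ->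
  bell_site succ x i m = bell_site succ y i m.
Proof.
move=> xy mn; rewrite -(subKn mn); move: (leq_subr m n); move: (n - m)%N.
elim=> [|d ih] dn; first by rewrite subn0 !bell_site_bottom.
have ltdn : (n - d.+1 < n)%N by rewrite ltn_subrL (leq_trans _ dn).
rewrite -[(n - d.+1)%N]/(nat_of_ord (Ordinal ltdn)) !bell_site_rec /=.
have [br _] := bell_site_reach x i ltdn.
by rewrite (xy _ (Ordinal ltdn)) // -subSn // subSS ih // ltnW.
Qed.

(** The reach is among the sites of agreement because its values decide which exchanges take place;
    beyond it a jump copies the state. *)
Lemma jump_eq_on L x y i : eq_on (reach i ++ L) x y ->
  eq_on (reach i ++ L) (jump succ pred x i) (jump succ pred y i).
Proof.
move=> xy; have xyr : eq_on (reach i) x y.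
  by apply: eq_on_sub xy => j; rewrite mem_cat => ->.
move=> j m jL; rewrite /jump /= -(bell_site_eq_on xyr (ltn_ord m)).
have [br pbr] := bell_site_reach x i (ltn_ord m).
by rewrite (xyr _ m br) (xyr _ m pbr) (xy _ m jL).
Qed.

(** One implication is enough, [eq_on] being symmetric. *)
Definition supported L B := forall x y, eq_on L x y -> B x -> B y.

Definition jump_preimage i B := [set x | B (jump succ pred x i)].

Lemma supportedP L B x y : supported L B -> eq_on L x y -> B x <-> B y.
Proof. by move=> sB xy; split; apply: sB => //; exact: eq_on_sym. Qed.

Lemma supported_jump_preimage L B i : supported L B ->
  supported (reach i ++ L) (jump_preimage i B).
Proof.
move=> sB x y /jump_eq_on xy; apply: sB; apply: eq_on_sub xy => j jL.
by rewrite mem_cat jL orbT.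
Qed.

Lemma jump_preimage_disjoint L B i : supported L B -> i \notin bells L ->
  jump_preimage i B = B.
Proof.
move=> sB iL; apply/funext => x; apply/propext.
apply: (supportedP sB); apply: jump_eq_on_disjoint.
by apply: contra iL => /hasP[j jr jL]; exact: mem_bells jr jL.
Qed.

(* A bell either leaves a line alone (hole at the bell) or exchanges the values
   at the bell and at its left neighbour (particle at the bell). *)
Definition exchange (b j : S) : S :=
  if j == pred b then b else if j == b then pred b else j.

Lemma exchangeK b : involutive (exchange b).
Proof.
move=> j; rewrite /exchange; have [->|jp] := eqVneq j (pred b).
  by rewrite eqxx; case: eqP.
by have [->|jb] := eqVneq j b; rewrite ?eqxx// (negPf jp) (negPf jb).
Qed.

Lemma jumpE x i j m :
  jump succ pred x i (j, m) =
  let b := bell_site succ x i m.+1 in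
  if x (b, m) == particle then x (exchange b j, m) else x (j, m).
Proof.
rewrite /jump /exchange /=; set b := bell_site _ _ _ _.
rewrite /particle; have [->|_] := eqVneq j (pred b).
  by case: (x (b, m)); case: (x (pred b, m)).
by have [->|_] := eqVneq j b; case: (x (b, m)); case: (x (pred b, m)).
Qed.

(** Once b_m is known, the new state tells which branch was taken. A particle at b_(m+1) = b_m has
    moved to [pred] b_m; a hole at b_(m+1) has stayed there, and b_(m+1) is then [pred] b_m. *)
Lemma jump_pred_bell_site x i (m : 'I_n) :
  (jump succ pred x i (pred (bell_site succ x i m), m) == particle) =
  (x (bell_site succ x i m.+1, m) == particle).
Proof.
rewrite jumpE /= bell_site_rec /=; set b := bell_site _ _ _ _.
case: ifP => [xb|xb]; rewrite xb; first by rewrite /exchange eqxx xb.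
by rewrite succK xb.
Qed.

(* The bell sites are recovered from the top line downwards by
   [jump_pred_bell_site], then the lines by [exchangeK]. *)
Lemma jump_bell_site_inj x y i j :
  jump succ pred x i = jump succ pred y j ->
  bell_site succ x i 0 = bell_site succ y j 0 -> x = y /\ i = j.
Proof.
move=> Exy E0.
have Eb m : (m <= n)%N -> bell_site succ x i m = bell_site succ y j m.
  elim: m => // m ih mn; have {}ih := ih (ltnW mn).
  have := jump_pred_bell_site x i (Ordinal mn).
  have := jump_pred_bell_site y j (Ordinal mn).
  rewrite -ih -Exy => -> xy; move: ih.
  rewrite (bell_site_rec _ x i (Ordinal mn)) (bell_site_rec _ y j (Ordinal mn)).
  by rewrite /= -xy; case: ifP => // _; exact: (can_inj succK).
have Eij : i = j by have := Eb n (leqnn n); rewrite !bell_site_bottom.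
split=> //; apply: funext => -[k m].
have Ebm := Eb m.+1 (ltn_ord m).
have := jump_pred_bell_site x i m.
rewrite (Eb m (ltnW (ltn_ord m))) Exy jump_pred_bell_site -Ebm => xy.
have jE l : jump succ pred x i (l, m) = jump succ pred y j (l, m) by rewrite Exy.
(* If there was an exchange, the value of x at k is found after the jump at the exchanged site;
   otherwise it is found at k. *)
move: (jE k) (jE (exchange (bell_site succ x i m.+1) k)).
by rewrite !jumpE /= -Ebm xy exchangeK; case: ifP.
Qed.

End Locality.

(** * Real analysis *)

(** Convexity of the power function, in the form needed for one Euler step: the tangent at x stays
    below the curve. *)
Lemma exprD_ge_tangent (R : realDomainType) (x h : R) (k : nat) :
  0 <= x -> 0 <= h -> x ^+ k.+1 + k.+1%:R * x ^+ k * h <= (x + h) ^+ k.+1.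
Proof.
move=> x0 h0; elim: k => [|k ih]; first by rewrite !expr1 expr0 !mul1r.
have xh0 : 0 <= x + h by rewrite addr_ge0.
rewrite [leRHS]exprS; apply: le_trans (ler_wpM2l xh0 ih).
rewrite -subr_ge0; set y := x ^+ k.
have -> : (x + h) * (x ^+ k.+1 + k.+1%:R * y * h) -
  (x ^+ k.+2 + k.+2%:R * x ^+ k.+1 * h) = k.+1%:R * y * h * h.
  by rewrite -(natr1 k.+1) /y !exprS; ring.
by rewrite !mulr_ge0 // exprn_ge0.
Qed.

(** Euler's method replaces integration, so G needs no regularity: with M steps of length t / M, the
    errors C h^2 add up to C t^2 / M, which tends to 0. *)
Lemma le_integrated_power_bound (R : realType) (D G : R -> R) (b C : R)
    (k : nat) (t : R) :
  0 <= b -> 0 <= C -> 0 <= t ->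
  (forall u h, 0 <= u -> 0 <= h -> `|D (u + h) - D u - h * G u| <= C * h ^+ 2) ->
  (forall u, 0 <= u -> `|G u| <= b * k.+1%:R * u ^+ k) ->
  D 0 = 0 -> `|D t| <= b * t ^+ k.+1.
Proof.
move=> b0 C0 t0 DG Gb D0.
have bound h j : 0 <= h ->
    `|D (j%:R * h)| <= b * (j%:R * h) ^+ k.+1 + j%:R * (C * h ^+ 2).
  move=> h0; elim: j => [|j ih].
    by rewrite !mul0r D0 normr0 expr0n /= mulr0 addr0.
  have u0 : 0 <= j%:R * h by rewrite mulr_ge0.
  rewrite -natr1 mulrDl mul1r; set u := j%:R * h in u0 ih *.
  have -> : D (u + h) = (D (u + h) - D u - h * G u) + D u + h * G u by ring.
  have := DG u h u0 h0; have := Gb u u0 => G1 D1.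
  apply: (le_trans (ler_normD _ _)).
  apply: (le_trans (lerD (ler_normD _ _) (lexx _))).
  rewrite normrM (ger0_norm h0).
  have := ler_wpM2l h0 G1.
  have := ler_wpM2l b0 (exprD_ge_tangent k u0 h0).
  move: (`|G u|) (`|D u|) (`|_|) ih D1 => g d e ih D1; nra.
apply/ler_addgt0Pr => e e0.
(* Makes C t^2 / M at most e; the successor keeps M nonzero. *)
pose M := (Num.bound (C * t ^+ 2 / e)).+1.
have M0 : 0 < M%:R :> R by rewrite ltr0n.
have := bound (t / M%:R) M (divr_ge0 t0 (ltW M0)).
have -> : M%:R * (t / M%:R) = t by field; rewrite gt_eqF.
move/le_trans; apply; rewrite lerD2l.
have -> : M%:R * (C * (t / M%:R) ^+ 2) = C * t ^+ 2 / M%:R by field; rewrite gt_eqF.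
rewrite ler_pdivrMr // [e * _]mulrC -ler_pdivrMr //.
apply: ltW; apply: (lt_le_trans (archi_boundP _)).
  by rewrite divr_ge0 ?(ltW e0)// mulr_ge0 // exprn_ge0.
by rewrite ler_nat.
Qed.

(** Take the largest initial interval on which f equals f a: the left condition puts its supremum in
    it, and the right condition forbids that supremum to be less than b. *)
Lemma eq_endpoints_of_locally_constant (R : realType) (U : Type) (f : R -> U)
    (a b : R) : a <= b ->
  (forall s, a < s -> s <= b -> \forall u \near s^'-, f u = f s) ->
  (forall s, a <= s -> s < b -> \forall u \near s^'+, f u = f s) ->
  f a = f b.
Proof.
move=> ab fl fr.
pose A := [set s | [/\ a <= s, s <= b & forall u, a <= u -> u <= s -> f u = f a]].
have Aa : A a by split=> // u au ua; congr f; apply/eqP; rewrite eq_le ua au.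
have ubA : has_sup A by split; [exists a | exists b => s []].
have cb : sup A <= b by apply: ge_sup; [exists a | move=> s []].
have ac : a <= sup A by apply: ub_le_sup => //; case: ubA.
have ltA u : a <= u -> u < sup A -> f u = f a.
  move=> au uc; have [s [_ _ fs]] := sup_adherent (ltac:(by rewrite subr_gt0) : 0 < sup A - u) ubA.
  by rewrite subKr => us; apply: fs => //; exact: ltW.
have fc : f (sup A) = f a.
  have [<-//|ac'] := eqVneq a (sup A).
  have {}ac' : a < sup A by rewrite lt_neqAle ac' ac.
  near (sup A)^'- => u; have <- : f u = f (sup A) by near: u; exact: fl.
  by apply: ltA; [apply: ltW; near: u; exact: nbhs_left_gt|].
have Ac : A (sup A).
  split=> // u au; rewrite le_eqVlt => /orP[/eqP->//|]; exact: ltA.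
have [<-//|cb'] := eqVneq (sup A) b.
have {}cb' : sup A < b by rewrite lt_neqAle cb' cb.
have := fr _ ac cb'; rewrite /at_right /within /= => /nbhs_ballP[e /= e0 he].
pose d := Num.min (sup A + e / 2) b.
have cd : sup A < d by rewrite /d lt_min cb' ltrDl divr_gt0.
suff Ad : A d by have := ub_le_sup ubA.2 Ad; rewrite leNgt cd.
split; first exact: le_trans (ltW cd).
  by rewrite /d ge_min lexx orbT.
move=> u au ud; have [uc|uc] := leP u (sup A); first by case: Ac => _ _; apply.
rewrite he //; rewrite /ball /= ltr_distlC; apply/andP; split; first lra.
by move: ud; rewrite /d le_min => /andP[ud _]; lra.
Unshelve. all: by end_near.
Qed.

(** * Paths *)

Section Paths.
Context (R : realType) (S : choiceType) (succ pred : S -> S) (n : nat).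
Hypotheses (predK : cancel pred succ) (succK : cancel succ pred).
Context (N : S -> R -> nat) (X : R -> config S n).
Hypotheses (N_mono : forall i s t, 0 <= s -> s <= t -> (N i s <= N i t)%N)
  (N_right : forall i t, 0 <= t -> \forall s \near t^'+, N i s = N i t)
  (NX : follows_bells succ pred N X).

(* Bells away from L may ring densely in ]t, t'], but at each such time the
   coordinates in L agree with their left limits. *)
Lemma quiet_eq_on (L : seq S) (t t' : R) : 0 <= t -> t <= t' ->
  (forall i, i \in bells succ pred n L -> N i t' = N i t) ->
  eq_on L (X t) (X t').
Proof.
move=> t0 tt' quiet j m jL.
pose f s := X s (j, m); rewrite -[LHS]/(f t) -[RHS]/(f t').
apply: eq_endpoints_of_locally_constant tt' _ _ => s ts st'; last first.
  by apply: (NX.1 s _ (j, m)); exact: le_trans t0 ts.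
have s0 : 0 < s by exact: le_lt_trans t0 ts.
have [x [lx rx nx]] := NX.2 s s0.
suff -> : f s = x (j, m) by exact: lx.
rewrite /f; have [[i ri]|nr] := pselect (exists i, rings (N i) s); last first.
  by rewrite nx // => i ri; apply: nr; exists i.
rewrite (rx i ri).
have iL : i \notin bells succ pred n L.
  apply/negP => /quiet Nt; have := ri t t0 ts.
  by rewrite -Nt ltnNge (N_mono _ (ltW s0) st').
apply: jump_eq_on_disjoint jL => //.
by apply: contra iL => /hasP[k kr kL]; exact: mem_bells kr kL.
Qed.

(** The values on these sites before a bell determine the values on L after it, wherever the bell
    rings. *)
Definition surroundings (L : seq S) : seq S :=
  L ++ flatten [seq reach succ pred n i | i <- bells succ pred n L].

(** The ring is at the infimum of the times where the counter exceeds its value at t.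
    Right-continuity makes this infimum attained, hence later than t. *)
Lemma first_ring (i : S) (t t' : R) : 0 <= t -> t <= t' ->
  N i t' = (N i t).+1 ->
  exists tau, [/\ t < tau, tau <= t', rings (N i) tau, N i tau = N i t' &
    forall s, t <= s -> s < tau -> N i s = N i t].
Proof.
move=> t0 tt' Nt'.
pose E := [set s | t <= s <= t' /\ (N i t < N i s)%N].
have Et' : E t' by split; rewrite ?tt' ?lexx// Nt'.
have infE : has_inf E by split; [exists t' | exists t => s [/andP[]]].
have tE : t <= inf E by apply: lb_le_inf; [exists t' | move=> s [/andP[]]].
have Et : inf E <= t' by apply: ge_inf => //; case: infE.
have E0 : 0 <= inf E by exact: le_trans t0 tE.
have before s : t <= s -> s < inf E -> N i s = N i t.
  move=> ts sE; apply/eqP; rewrite eqn_leq (N_mono _ t0 ts) andbT leqNgt.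
  apply/negP => Ns; suff Es : E s by have := ge_inf infE.2 Es; rewrite leNgt sE.
  by split=> //; rewrite ts /=; apply: ltW; exact: lt_le_trans sE Et.
have NE : (N i t < N i (inf E))%N.
  rewrite ltnNge; apply/negP => NE.
  have {}NE : N i (inf E) = N i t by apply/eqP; rewrite eqn_leq NE N_mono.
  have := N_right i E0; rewrite /at_right /within /= => /nbhs_ballP[e /= e0 he].
  have [s [/andP[ts st'] Ns]] := inf_adherent e0 infE.
  have [sE|sE|sE] := ltgtP s (inf E); last by rewrite sE NE ltnn in Ns.
    by rewrite before// ltnn in Ns.
  move=> se; suff Es : N i s = N i (inf E) by rewrite Es NE ltnn in Ns.
  apply: he => //.
  by rewrite /ball /= ltr_distlC; apply/andP; split; lra.
have tlt : t < inf E.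
  by rewrite lt_neqAle tE andbT; apply/eqP => tE'; rewrite -tE' ltnn in NE.
exists (inf E); split=> //.
  move=> s s0 sE; apply: leq_ltn_trans NE.
  have [ts|/ltW ts] := leP t s; first by rewrite before.
  exact: N_mono.
by apply/eqP; rewrite eqn_leq N_mono //= Nt'.
Qed.

(** The interval is cut at the ring of i. Before it the surroundings are frozen, so the left limit
    there agrees with X t; after it L is frozen. *)
Lemma single_bell_eq_on (L : seq S) (i : S) (t t' : R) : 0 <= t -> t <= t' ->
  N i t' = (N i t).+1 ->
  (forall k, k \in bells succ pred n (surroundings L) -> k != i ->
     N k t' = N k t) ->
  eq_on L (X t') (jump succ pred (X t) i).
Proof.
move=> t0 tt' Ni quiet; set L' := surroundings L in quiet *.
have LL' : {subset L <= L'} by move=> j jL; rewrite mem_cat jL.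
have [tau [ttau taut' ri Ntau before]] := first_ring t0 tt' Ni.
have tau0 : 0 < tau by exact: le_lt_trans t0 ttau.
have [x [lx /(_ _ ri) Xtau _]] := NX.2 tau tau0.
have xX : eq_on L' x (X t).
  move=> j m jL'; near tau^'- => s.
  have ts : t < s by near: s; exact: nbhs_left_gt.
  have st : s < tau by [].
  have s0 : 0 <= s by apply: ltW; exact: le_lt_trans t0 ts.
  have <- : X s (j, m) = x (j, m) by near: s; exact: lx.
  apply/esym; apply: (@quiet_eq_on L' t s) => //; first exact: ltW.
  move=> k kL'; have [->|ki] := eqVneq k i; first by rewrite before // ltW.
  apply/eqP; rewrite eqn_leq (N_mono _ t0 (ltW ts)) andbT -(quiet k)//.
  by apply: N_mono => //; apply: ltW; exact: lt_le_trans st taut'.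
have after : eq_on L (X tau) (X t').
  apply: quiet_eq_on => // [|k]; first exact: ltW.
  case/allpairsP=> -[j l] [/= jL li kE].
  have {li kE} : k \in bells succ pred n L'.
    by rewrite kE; apply: allpairs_f => //; exact: LL'.
  have [->//|ki kL'] := eqVneq k i; apply/eqP; rewrite eqn_leq.
  rewrite (N_mono _ (ltW tau0) taut') andbT (quiet k) //.
  by apply: N_mono => //; exact: ltW.
apply: eq_on_trans (eq_on_sym after) _; rewrite Xtau.
(* A bell near L reads only sites of the surroundings; a bell far from L leaves L unchanged in both
   states. *)
have [iL|iL] := boolP (i \in bells succ pred n L).
  have /(jump_eq_on predK succK) : eq_on (reach succ pred n i ++ L) x (X t).
    apply: eq_on_sub xX => j; rewrite !mem_cat => /orP[jr|->//].
    by apply/orP; right; apply/flattenP; exists (reach succ pred n i); rewrite ?map_f.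
  by apply: eq_on_sub => j; rewrite mem_cat orbC => ->.
have dis : ~~ has [in L] (reach succ pred n i).
  by apply: contra iL => /hasP[k kr kL]; exact: mem_bells kr kL.
apply: (eq_on_trans (jump_eq_on_disjoint predK succK x dis)).
apply: eq_on_trans (eq_on_sym (jump_eq_on_disjoint predK succK (X t) dis)).
exact: eq_on_sub xX.
Unshelve. all: by end_near.
Qed.

End Paths.

(** * The law over a short time *)

(** The exceptional set need not be measurable, so B is enlarged by a measurable null set containing
    it. *)
Lemma prob_le_ae d (T : measurableType d) (R : realType) (P : probability T R)
    (A B : set T) : measurable A -> measurable B ->
  {ae P, forall w, A w -> B w} -> (P A <= P B)%E.
Proof.
move=> mA mB [Z [mZ Z0 ZS]].
apply: (@le_trans _ _ (P (B `|` Z))).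
  apply: le_measure; rewrite ?inE//; first exact: measurableU.
  move=> w Aw; have [Bw|Bw] := pselect (B w); [by left|right].
  by apply: ZS => /= AB; apply: Bw; exact: AB.
by apply: (le_trans (measureU2 _ mB mZ)); rewrite -[leRHS]adde0 -Z0.
Qed.

Lemma sum_prob_disjoint_le d (T : measurableType d) (R : realType)
    (P : probability T R) (I : choiceType) (s : seq I) (E : I -> set T) (U : set T) :
  uniq s -> (forall i, i \in s -> measurable (E i)) -> measurable U ->
  (forall i j, i \in s -> j \in s -> i != j -> E i `&` E j = set0) ->
  {ae P, forall w, forall i, i \in s -> E i w -> U w} ->
  (\sum_(i <- s) P (E i) <= P U)%E.
Proof.
move=> us mE mU dE EU.
rewrite fsbig_seq // -measure_fin_bigcup //.
- apply: prob_le_ae => //; first exact: fin_bigcup_measurable.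
  by apply: filterS EU => w Ew [i si Ei]; exact: Ew si Ei.
- move=> i j si sj [w Eijw]; apply/eqP; apply: contraPT Eijw => ij.
  by rewrite (dE i j).
Qed.

Section Measurability.
Context (S : choiceType) (n : nat).

Lemma measurable_cylinder (c : S * 'I_n) v :
  measurable ([set x | x c = v] : set (config S n)).
Proof. by apply: sub_sigma_algebra; exists c, v. Qed.

(** Induction on the coordinates: B is split along the two values of the first one, which [update]
    then freezes. *)
Lemma measurable_finitely_determined (cs : seq (S * 'I_n)) (B : set (config S n)) :
  (forall x y : config S n, {in cs, x =1 y} -> B x -> B y) -> measurable B.
Proof.
elim: cs B => [|c cs ih] B sB.
  have [->|/set0P[x Bx]] := eqVneq B set0; first exact: measurable0.
  by rewrite (_ : B = setT) //; apply/seteqP; split=> // y _; exact: sB Bx.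
pose update v (x : config S n) : config S n := fun c' => if c' == c then v else x c'.
have mB v : measurable [set x | B (update v x)].
  apply: ih => x y xy; apply: sB => c' c'cs; rewrite /update.
  by case: eqVneq => // c'c; apply: xy; move: c'cs; rewrite inE (negPf c'c).
have updE (x : config S n) : update (x c) x = x.
  by apply/funext => c'; rewrite /update; case: eqP => // ->.
rewrite (_ : B =
  ([set x | x c = true] `&` [set x | B (update true x)]) `|`
  ([set x | x c = false] `&` [set x | B (update false x)])).
  by apply: measurableU; apply: measurableI => //; exact: measurable_cylinder.
apply/seteqP; split=> x /=.
  move=> Bx; case E : (x c); [left|right]; split=> //; by rewrite -E updE.
by move=> [] [E]; rewrite -E updE.
Qed.

Lemma measurable_supported (L : seq S) (B : set (config S n)) :
  supported L B -> measurable B.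
Proof.
move=> sB; apply: (@measurable_finitely_determined [seq (j, m) | j <- L, m <- enum 'I_n]).
move=> x y xy; apply: sB => j m jL; apply: xy.
by apply: allpairs_f => //; rewrite mem_enum.
Qed.

End Measurability.

Section OneStep.
Context (R : realType) (S : choiceType) (succ pred : S -> S) (n : nat).
Hypotheses (predK : cancel pred succ) (succK : cancel succ pred).
Context d (T : measurableType d) (P : probability T R).
Context (F : R -> set (set T)) (N : S -> R -> T -> nat)
        (X : R -> T -> config S n).
Hypothesis NX : multiline_process succ pred P F N X.

Definition law t (B : set (config S n)) : R := fine (P (X t @^-1` B)).

Lemma measurable_state t (B : set (config S n)) :
  0 <= t -> measurable B -> measurable (X t @^-1` B).
Proof. by case: NX => -[_ Fm _] _ Xm _ t0 mB; apply: (Fm t t0); exact: Xm. Qed.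

Lemma lawE t (B : set (config S n)) : 0 <= t -> measurable B ->
  P (X t @^-1` B) = (law t B)%:E.
Proof.
by move=> t0 mB; rewrite /law fineK // fin_num_measure //; exact: measurable_state.
Qed.

Lemma law_bounds t (B : set (config S n)) : 0 <= t -> measurable B ->
  0 <= law t B <= 1.
Proof.
move=> t0 mB; rewrite -!lee_fin -lawE // measure_ge0 /=.
by apply: probability_le1; exact: measurable_state.
Qed.

Lemma law_setC t (B : set (config S n)) : 0 <= t -> measurable B ->
  law t (~` B) = 1 - law t B.
Proof.
move=> t0 mB; apply: EFin_inj; rewrite -lawE //; last exact: measurableC.
by rewrite preimage_setC probability_setC ?lawE//; exact: measurable_state.
Qed.

Definition increments (A : {fset S}) (k : S -> nat) (t h : R) : set T :=
  \bigcap_(i in [set` A]) [set w | N i (t + h) w = (N i t w + k i)%N].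

Lemma measurable_increments A k t h : 0 <= t -> 0 <= h ->
  measurable (increments A k t h).
Proof.
move=> t0 h0; have [[_ Fm _] [_ NF _] _ _] := NX.
have mN i s l : 0 <= s -> measurable [set w | N i s w = l].
  by move=> s0; apply: (Fm s s0); exact: NF.
apply: fin_bigcap_measurable => [|i _]; first exact: finite_fset.
rewrite (_ : [set w | _] = \bigcup_l
  ([set w | N i t w = l] `&` [set w | N i (t + h) w = (l + k i)%N])).
  by apply: bigcup_measurable => l _; apply: measurableI; apply: mN => //; exact: addr_ge0.
apply/seteqP; split=> w /=; first by move=> E; exists (N i t w).
by move=> [l _ [/= -> ->]].
Qed.

Lemma prob_increments A k t h (B : set (config S n)) :
  0 <= t -> 0 < h -> measurable B ->
  P (X t @^-1` B `&` increments A k t h) =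
  (law t B * \prod_(i <- A) poisson_pmf h (k i))%:E.
Proof.
move=> t0 h0 mB; have [_ [_ _ ind] Xm _] := NX.
rewrite /increments (ind t (t + h)) ?ltrDl//; last exact: Xm.
by rewrite lawE // EFinM addrAC subrr add0r.
Qed.

Lemma prod_poisson_pmf_zero (A : {fset S}) (h : R) : 0 < h ->
  \prod_(i <- A) poisson_pmf h 0 = expR (- (#|` A|%:R * h)).
Proof.
move=> h0; rewrite /poisson_pmf h0 big_const_seq count_predT iter_mulr_1.
by rewrite expr0 fact0 divr1 mul1r -expRM_natl mulrN.
Qed.

Lemma prod_poisson_pmf_one (A : {fset S}) (i : S) (h : R) : 0 < h -> i \in A ->
  \prod_(j <- A) poisson_pmf h (j == i) = h * expR (- (#|` A|%:R * h)).
Proof.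
(* Going from no ring to one ring multiplies the Poisson weight by h, and this happens at i only. *)
move=> h0 iA; have -> : \prod_(j <- A) poisson_pmf h (j == i) =
    \prod_(j <- A) ((if j == i then h else 1) * poisson_pmf h 0).
  apply: eq_bigr => j _; rewrite /poisson_pmf h0.
  by case: eqP => _; rewrite !(expr0, expr1, fact0, factS, mul1n) !divr1 ?mul1r.
rewrite big_split /= prod_poisson_pmf_zero //; congr (_ * _).
rewrite -big_mkcond /= -big_filter filter_pred1_uniq ?fset_uniq //.
by rewrite big_seq1.
Qed.

(** The right side is bounded below by disjoint events of explicit probability: no ring in A from a
    state of B, or a single ring, at i, from a state of [jump_preimage i B]. Two or more rings are
    discarded. *)
Lemma law_step_lower (L : seq S) (B : set (config S n)) (A : {fset S}) t h :
  supported L B ->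
  {subset bells succ pred n (surroundings succ pred n L) <= A} ->
  0 <= t -> 0 < h ->
  expR (- (#|` A|%:R * h)) *
    (law t B + h * \sum_(i <- A) law t (jump_preimage succ pred i B))
  <= law (t + h) B.
Proof.
move=> sB LA t0 h0.
have mB := measurable_supported sB.
have mJ i : measurable (jump_preimage succ pred i B).
  exact: measurable_supported (supported_jump_preimage predK succK (i := i) sB).
have th0 : 0 <= t + h by rewrite addr_ge0 // ltW.
pose E (o : option S) := if o is Some i
  then X t @^-1` jump_preimage succ pred i B `&` increments A (fun j => j == i) t h
  else X t @^-1` B `&` increments A (fun=> 0%N) t h.
rewrite -lee_fin -lawE //.
have -> : (expR (- (#|` A|%:R * h)) *
    (law t B + h * \sum_(i <- A) law t (jump_preimage succ pred i B)))%:E =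
    (\sum_(o <- None :: map Some A) P (E o))%E.
  rewrite big_cons big_map /= prob_increments // prod_poisson_pmf_zero //.
  rewrite mulrDr mulr_sumr mulr_sumr EFinD mulrC -sumEFin; congr (_ + _)%E.
  apply: eq_big_seq => i iA; rewrite prob_increments // prod_poisson_pmf_one //.
  by congr EFin; ring.
apply: sum_prob_disjoint_le.
- rewrite /= map_inj_uniq ?fset_uniq ?andbT; last exact: Some_inj.
  by apply/mapP => -[].
- by move=> [i|] _; apply: measurableI;
    [exact: measurable_state|apply: measurable_increments => //; exact: ltW
    |exact: measurable_state|apply: measurable_increments => //; exact: ltW].
- exact: measurable_state.
- have memA i : Some i \in None :: [seq Some i | i <- A] -> i \in A.
    by rewrite inE /= => /mapP[j jA [->]].
  move=> [i|] [j|] // si sj ij; apply/seteqP; split=> // w [] /= [_ wi] [_ wj].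
  + have := wi i (memA _ si); rewrite /= (wj i (memA _ si)) eqxx.
    have /negPf -> : i != j by apply: contra_neq ij => ->.
    lia.
  + by have := wi i (memA _ si); rewrite /= (wj i (memA _ si)) eqxx; lia.
  + by have := wi j (memA _ sj); rewrite /= (wj j (memA _ sj)) eqxx; lia.
- have [_ [Nw _ _] _] := NX; apply: filterS => w Xw.
  have N_mono i s u : 0 <= s -> s <= u -> (N i s w <= N i u w)%N.
    by have [_ + _] := Nw i w; exact.
  have N_right i s : 0 <= s -> \forall r \near s^'+, N i r w = N i s w.
    by have [_ _] := Nw i w; exact.
  have tth : t <= t + h by rewrite lerDl ltW.
  move=> [i|] si [/= Bw Ew].
    have iA : i \in A by move: si; rewrite inE /= => /mapP[j jA [->]].
    move: Bw; apply: (supportedP sB _).1; apply: eq_on_sym.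
    apply: (single_bell_eq_on predK succK _ _ Xw) => //.
    + by rewrite (Ew i iA) eqxx addn1.
    + by move=> k /LA kA /negPf ki; rewrite (Ew k kA) ki addn0.
  apply: sB Bw; apply: (quiet_eq_on predK succK _ Xw) => //.
  move=> k kL; rewrite Ew ?addn0//=; apply: LA.
  case/allpairsP: kL => -[j l] [/= jL li ->].
  by apply: allpairs_f => //; rewrite mem_cat jL.
Qed.

(* The upper bound is the lower bound applied to the complement of B. *)
Lemma law_step (L : seq S) (B : set (config S n)) (A : {fset S}) t h :
  supported L B ->
  {subset bells succ pred n (surroundings succ pred n L) <= A} ->
  0 <= t -> 0 <= h ->
  `|law (t + h) B - law t B -
    h * \sum_(i <- A) (law t (jump_preimage succ pred i B) - law t B)|
  <= #|` A|%:R ^+ 2 * h ^+ 2.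
Proof.
move=> sB LA t0; rewrite le_eqVlt => /orP[/eqP<-|h0].
  by rewrite addr0 subrr mul0r subr0 normr0 expr0n mulr0.
have mB := measurable_supported sB.
have mJ i : measurable (jump_preimage succ pred i B).
  exact: measurable_supported (supported_jump_preimage predK succK (i := i) sB).
have sBC : supported L (~` B).
  by move=> x y /eq_on_sym xy nB /(sB _ _ xy).
have lo := law_step_lower sB LA t0 h0.
have := law_step_lower sBC LA t0 h0.
rewrite !law_setC ?addr_ge0 ?(ltW h0)//.
under eq_bigr do rewrite (law_setC t0 (mJ _)) -/(jump_preimage _ _ _ _).
rewrite !sumrB !big_const_seq !count_predT !iter_addr_0.
set s := \sum_(i <- A) _ in lo *.
have s0 : 0 <= s <= #|` A|%:R.
  apply/andP; split; first by apply: sumr_ge0 => i _; case/andP: (law_bounds t0 (mJ i)).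
  rewrite -sum1_size natr_sum; apply: ler_sum => i _.
  by case/andP: (law_bounds t0 (mJ i)).
have := law_bounds t0 mB; have : 0 <= #|` A|%:R :> R by [].
rewrite -[law t B *+ _]mulr_natl.
set a := #|` A|%:R in lo s0 *; set p := law t B in lo *; set q := law (t + h) B in lo *.
have := expR_ge1Dx (- (a * h)).
set e := expR _ in lo * => e1 a0 /andP[p0 p1] hi.
have [s0' sa] := andP s0.
have hs : 0 <= h * s by rewrite mulr_ge0 // ltW.
have hsa : h * s <= a * h by rewrite mulrC ler_wpM2r // ltW.
have ah : 0 <= a * h by rewrite mulr_ge0 // ltW.
have -> : h * (s - a * p) = h * s - a * h * p by ring.
have -> : a ^+ 2 * h ^+ 2 = (a * h) ^+ 2 by ring.
have {}hi : e * (1 - p + (a * h - h * s)) <= 1 - q.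
  by apply: le_trans hi; rewrite le_eqVlt; apply/orP; left; apply/eqP; ring.
(* With x = a h and y = h s, the two lower bounds leave errors x y and x (x - y), both at most x^2
   since 0 <= y <= x. *)
move: (h * s) (a * h) hs hsa ah lo hi e1 => y x y0 yx x0 lo hi e1.
have : (1 - x) * (p + y) <= q by apply: le_trans lo; apply: ler_wpM2r; lra.
have : (1 - x) * (1 - p + (x - y)) <= 1 - q by apply: le_trans hi; apply: ler_wpM2r; lra.
by move=> ? ?; rewrite ler_norml; apply/andP; split; nra.
Qed.

End OneStep.

(** * Stationarity from balance *)

Lemma leq_bin_expn2 (m k : nat) : ('C(m, k) <= 2 ^ m)%N.
Proof.
elim: m k => [|m ih] [|k]; rewrite ?bin0 ?bin0n ?expn_gt0 //.
by rewrite binS expnS mul2n -addnn leq_add.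
Qed.

Section Stationarity.
Context (R : realType) (S : choiceType) (succ pred : S -> S) (n : nat).
Hypotheses (predK : cancel pred succ) (succK : cancel succ pred).
Variable nu : set (config S n) -> \bar R.
Hypothesis balance_on_some : forall L B, supported L B ->
  exists2 A : {fset S}, {subset bells succ pred n L <= A} &
  \sum_(i <- A) (fine (nu (jump_preimage succ pred i B)) - fine (nu B)) = 0.

(** Terms outside [bells L] vanish, so the sum is the same for every such A. Each model can thus
    prove balance on a convenient set of sites. *)
Lemma balance L B (A : {fset S}) : supported L B ->
  {subset bells succ pred n L <= A} ->
  \sum_(i <- A) (fine (nu (jump_preimage succ pred i B)) - fine (nu B)) = 0.
Proof.
move=> sB LA; have [A' LA' sum0] := balance_on_some sB; rewrite -[RHS]sum0.
pose bL := [fset i in bells succ pred n L]%fset.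
have bLE : forall C : {fset S}, {subset bells succ pred n L <= C} ->
    \sum_(i <- bL) (fine (nu (jump_preimage succ pred i B)) - fine (nu B)) =
    \sum_(i <- C) (fine (nu (jump_preimage succ pred i B)) - fine (nu B)).
  move=> C LC; apply: big_fset_incl; first by apply/fsubsetP => i; rewrite inE => /LC.
  move=> i _; rewrite inE => iL.
  by rewrite (jump_preimage_disjoint predK succK sB) // subrr.
by rewrite -(bLE _ LA) (bLE _ LA').
Qed.

Section LawOfProcess.
Context d (T : measurableType d) (P : probability T R).
Context (F : R -> set (set T)) (N : S -> R -> T -> nat)
        (X : R -> T -> config S n).
Hypothesis NX : multiline_process succ pred P F N X.

Let discrepancy t B := law P X t B - fine (nu B).

Let stationary_at s := forall L B, supported L B -> discrepancy s B = 0.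

Let c : nat := n.+1.

(** Induction on K through the integral equation. A jump preimage adds c sites, turning r into r +
    1; the factors r + 1, r + 2, ..., divided by the K! from integrating powers, form the
    binomial. *)
Lemma discrepancy_bound (K r : nat) s L B u : 0 <= s -> stationary_at s ->
  supported L B -> (size L <= c * r)%N -> 0 <= u ->
  `|discrepancy (s + u) B| <=
    (2 * c%:R ^+ 2) ^+ K * 'C(r + K, K)%:R * u ^+ K.
Proof.
move=> s0 sts; elim: K r L B u => [|K ih] r L B u sB Lr u0.
  have mB := measurable_supported sB.
  rewrite addn0 bin0 !expr0 !mulr1 /discrepancy -[fine _]add0r -(subr0 (fine _)).
  have /eqP := sts L B sB; rewrite subr_eq0 => /eqP <-.
  have := law_bounds NX s0 mB; have := law_bounds NX (addr_ge0 s0 u0) mB.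
  move=> /andP[? ?] /andP[? ?]; rewrite ler_norml; apply/andP; split; lra.
pose L' := surroundings succ pred n L.
pose A := [fset i in bells succ pred n L']%fset.
have LL' : {subset bells succ pred n L <= A}.
  move=> i; rewrite inE => /allpairsP[-[j l] [/= jL li ->]].
  by apply: allpairs_f => //; rewrite mem_cat jL.
pose G v := \sum_(i <- A) (discrepancy (s + v) (jump_preimage succ pred i B)
                           - discrepancy (s + v) B).
pose D v := discrepancy (s + v) B.
rewrite -[discrepancy _ _]/(D u).
apply: (@le_integrated_power_bound _ D G
  ((2 * c%:R ^+ 2) ^+ K.+1 * 'C(r + K.+1, K.+1)%:R) (#|` A|%:R ^+ 2)) => //.
- move=> v h v0 h0.
  have LA : {subset bells succ pred n L' <= A} by move=> i; rewrite inE.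
  apply: le_trans (law_step predK succK NX sB LA (addr_ge0 s0 v0) h0).
  rewrite -(addrA s v h).
  (* By balance nu cancels from the sum, so the discrepancy obeys the same equation as the law. *)
  have -> : G v = \sum_(i <- A) (law P X (s + v) (jump_preimage succ pred i B) -
      law P X (s + v) B).
    apply/eqP; rewrite -subr_eq0 -sumrB -oppr_eq0 -sumrN.
    rewrite -[X in _ == X](balance sB LL'); apply/eqP/eq_bigr => i _.
    by rewrite /discrepancy; ring.
  by rewrite /D /discrepancy le_eqVlt; apply/orP; left; apply/eqP; congr `|_|; ring.
- move=> v v0.
  pose beta : R := (2 * c%:R ^+ 2) ^+ K * 'C(r.+1 + K, K)%:R * v ^+ K.
  have beta0 : 0 <= beta by rewrite !mulr_ge0 // exprn_ge0 // mulr_ge0 // exprn_ge0.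
  (* [A] is as large as [law_step] requires, but only the bells of L contribute, and there are at
     most r c^2 of them. *)
  have bound i : `|discrepancy (s + v) (jump_preimage succ pred i B)
      - discrepancy (s + v) B| <= if i \in bells succ pred n L then 2 * beta else 0.
    case: ifP => iL; last first.
      by rewrite (jump_preimage_disjoint predK succK sB) ?iL// subrr normr0.
    apply: (le_trans (ler_normB _ _)); rewrite [2 * _]mulr_natl mulr2n; apply: lerD.
      apply: ih (supported_jump_preimage predK succK (i := i) sB) _ v0.
      by rewrite size_cat size_reach mulnS leq_add2l.
    by apply: ih sB _ v0; rewrite mulnS (leq_trans Lr) // leq_addl.
  rewrite /G; apply: (le_trans (ler_norm_sum _ _ _)).
  apply: (le_trans (ler_sum _ (fun i _ => bound i))).
  rewrite -big_mkcond /= -big_filter big_const_seq count_predT iter_addr_0.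
  have szA : (size [seq i <- A | i \in bells succ pred n L] <= r * (c * c))%N.
    apply: (@leq_trans (size (bells succ pred n L))).
      apply: uniq_leq_size; first by rewrite filter_uniq.
      by move=> i; rewrite mem_filter => /andP[].
    by rewrite size_bells mulnA leq_mul2r (mulnC r) Lr orbT.
  apply: (@le_trans _ _ ((r * (c * c))%:R * (2 * beta))).
    by rewrite -[leLHS]mulr_natl ler_wpM2r ?ler_nat // mulr_ge0.
  (* (K + 1) binom(r + K + 1, K + 1) = (r + 1) binom(r + K + 1, K); the count r is then bounded by r
     + 1. *)
  have -> : (2 * c%:R ^+ 2) ^+ K.+1 * 'C(r + K.+1, K.+1)%:R * K.+1%:R =
      2 * c%:R ^+ 2 * (2 * c%:R ^+ 2) ^+ K * (r.+1%:R * 'C(r.+1 + K, K)%:R) :> R.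
    rewrite -addSnnS -mulrA -natrM mulnC mul_bin_left addnK natrM.
    by rewrite exprS.
  rewrite -subr_ge0 /beta -(natr1 r) !natrM.
  set a := c%:R; set b := _ ^+ K; set x := v ^+ K; set z := 'C(_, _)%:R; set y := r%:R.
  have -> : 2 * a ^+ 2 * b * ((y + 1) * z) * x - y * (a * a) * (2 * (b * z * x)) =
    2 * a ^+ 2 * (b * z * x) by ring.
  by rewrite mulr_ge0 // mulr_ge0 // exprn_ge0.
- by rewrite /D addr0; exact: sts sB.
Qed.

(* Twice smaller than the radius of convergence, after binom(m, K) <= 2^m. *)
Let tau : R := (8 * c%:R ^+ 2)^-1.

Lemma stationary_at_add s u : 0 <= s -> stationary_at s -> 0 <= u -> u <= tau ->
  stationary_at (s + u).
Proof.
move=> s0 sts u0 utau L B sB; apply/eqP; rewrite -normr_le0.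
pose r := size L; have Lr : (size L <= c * r)%N by rewrite leq_pmull.
have c0 : 0 < c%:R ^+ 2 :> R by rewrite exprn_gt0 // ltr0n.
apply/ler_addgt0Pr => e e0; rewrite add0r.
(* At [tau] the bound becomes 2^r / 2^K, and 2^r / e < K < 2^K. *)
pose K := Num.bound (2 ^+ r / e).
apply: (le_trans (discrepancy_bound K s0 sts sB Lr u0)).
apply: (@le_trans _ _ ((2 * c%:R ^+ 2) ^+ K * (2 ^+ (r + K)) * tau ^+ K)).
  apply: ler_pM; rewrite ?mulr_ge0 ?exprn_ge0 ?mulr_ge0 ?(ltW c0)//.
    apply: ler_wpM2l; first by rewrite exprn_ge0 // mulr_ge0 // ltW.
    by rewrite -natrX ler_nat leq_bin_expn2.
  by rewrite lerXn2r ?nnegrE// /tau invr_ge0 mulr_ge0 // ltW.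
have -> : (2 * c%:R ^+ 2) ^+ K * 2 ^+ (r + K) * tau ^+ K = 2 ^+ r / 2 ^+ K :> R.
  have E : 2 * c%:R ^+ 2 * 2 * tau = 2^-1 by rewrite /tau; field; rewrite gt_eqF.
  by rewrite exprD -exprVn -E !exprMn; ring.
rewrite ler_pdivrMr ?exprn_gt0// [e * _]mulrC -ler_pdivrMr //; apply: ltW.
apply: (lt_trans (archi_boundP _)); first by rewrite divr_ge0 ?exprn_ge0 // ltW.
by rewrite -/K -(natrX _ 2 K) ltr_nat ltn_expl.
Qed.

(** The step [tau] depends neither on the event nor on the starting time, so the argument can be
    restarted at each multiple of it. *)
Lemma stationary_at_all t : stationary_at 0 -> 0 <= t -> stationary_at t.
Proof.
move=> st0 t0.
have tau0 : 0 < tau by rewrite invr_gt0 mulr_gt0 // exprn_gt0 // ltr0n.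
have step j : forall u, 0 <= u -> u <= j%:R * tau -> stationary_at u.
  elim: j => [|j ih] u u0.
    by rewrite mul0r => u0'; have -> : u = 0 by apply/eqP; rewrite eq_le u0 u0'.
  rewrite -natr1 mulrDl mul1r => uj.
  have [utau|/ltW tauu] := leP u tau.
    by rewrite -[u]add0r; exact: stationary_at_add.
  have -> : u = (u - tau) + tau by ring.
  have ut0 : 0 <= u - tau by rewrite subr_ge0.
  apply: stationary_at_add => //; last exact: ltW.
  by apply: ih => //; rewrite lerBlDr.
apply: (step (Num.bound (t / tau)) t t0).
by rewrite -ler_pdivrMr //; apply/ltW/archi_boundP; rewrite divr_ge0 // ltW.
Qed.

End LawOfProcess.

Definition finitely_supported : set (set (config S n)) :=
  [set B | exists L, supported L B].

Lemma setI_closed_finitely_supported : setI_closed finitely_supported.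
Proof.
move=> A B [L sA] [L' sB]; exists (L ++ L') => x y xy [Ax Bx]; split.
  by apply: sA Ax; apply: eq_on_sub xy => j jL; rewrite mem_cat jL.
by apply: sB Bx; apply: eq_on_sub xy => j jL; rewrite mem_cat jL orbT.
Qed.

Lemma measurable_generated_finitely_supported :
  (measurable : set (set (config S n))) = <<s finitely_supported >>.
Proof.
apply/seteqP; split.
  apply: sub_smallest2r; first exact: smallest_sigma_algebra.
  move=> _ [[j m] [v ->]]; exists [:: j] => x y xy /= <-.
  by rewrite xy ?mem_head.
apply: smallest_sub; first exact: sigma_algebra_measurable.
by move=> B [L sB]; exact: measurable_supported sB.
Qed.

(** Finitely supported events are closed under intersection and generate the sigma-algebra, so a
    finite measure is determined by them. *)
Lemma stationary_of_balance : stationary succ pred nu.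
Proof.
move=> d T P F N X NX X0 t t0 B mB.
have mX s : 0 <= s -> measurable_fun setT (X s).
  by move=> s0 _ C mC; rewrite setTI; exact: (measurable_state NX).
rewrite -X0 //.
have law0 : forall L C, supported L C -> law P X 0 C - fine (nu C) = 0.
  by move=> L C sC; rewrite /law X0 ?subrr //; exact: measurable_supported sC.
(* The law of X t is compared with that of X 0 rather than with nu, which is only a set function
   here. *)
pose push s s0 := measure_function_pushforward__canonical__measure_function_Measure P (mX s s0).
rewrite -[LHS]/(push t t0 B) -[RHS]/(push 0 (lexx 0) B).
apply: (measure_unique finitely_supported (fun=> setT)
  measurable_generated_finitely_supported setI_closed_finitely_supported _ _
  (push t t0) (push 0 (lexx 0)) _ _ _ mB).
- by move=> _; exists [::].
- by rewrite bigcup_const //; exists 0%N.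
- move=> C [L sC]; have mC := measurable_supported sC.
  rewrite /= /pushforward /= X0 // (lawE NX t0 mC).
  have /eqP := stationary_at_all NX law0 t0 sC; rewrite subr_eq0 => /eqP ->.
  by rewrite fineK // -X0 // fin_num_measure //; exact: (measurable_state NX).
- by move=> _; rewrite /= /pushforward /= preimage_setT probability_setT ltry.
Qed.

End Stationarity.

(** * Balance on the cycle *)

Section FiniteSites.
Context (R : realType) (S : finType) (succ pred : S -> S) (n : nat).
Hypothesis succK : cancel succ pred.

Local Notation fconfig := {ffun S * 'I_n -> bool}.

Definition mass (w : config S n -> R) (B : set (config S n)) : R :=
  \sum_(f : fconfig | `[< B f >]) w f.

Lemma sum_mass_jump (w : config S n -> R) (B : set (config S n)) :
  (forall x i, w (jump succ pred x i) = w x) ->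
  \sum_(i : S) (mass w (jump_preimage succ pred i B) - mass w B) = 0.
Proof.
move=> wJ; apply/eqP; rewrite sumrB subr_eq0; apply/eqP.
pose Phi (p : fconfig * S) : fconfig * S :=
  ([ffun c => jump succ pred (p.1 : config S n) p.2 c],
   bell_site succ (p.1 : config S n) p.2 0).
have Phi1 p : (Phi p).1 = jump succ pred (p.1 : config S n) p.2 :> config S n.
  by apply/funext => c; rewrite ffunE.
have PhiI : injective Phi.
  move=> [f i] [g j] E; have E1 := congr1 (fun p : fconfig * S => p.1 : config S n) E.
  rewrite !Phi1 /= in E1.
  have [fg ->] := jump_bell_site_inj succK E1 (congr1 snd E).
  by congr pair; apply/ffunP => c; exact: (congr1 (@^~ c) fg).
rewrite /mass !pair_big_dep /=.
(* Invariance of w lets the summand depend on [Phi] p alone; [Phi], an injection of a finite type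
   into itself, is then a change of variables. *)
transitivity (\sum_(p : fconfig * S | `[< B (Phi p).1 >]) w (Phi p).1).
  rewrite (reindex (fun p : fconfig * S => (p.2, p.1))) /=.
    by apply: eq_big => [p|p _]; rewrite Phi1 // wJ.
  by exists (fun p => (p.2, p.1)) => -[].
transitivity (\sum_(p : fconfig * S | `[< B p.1 >]) w p.1).
  by rewrite [RHS](reindex_inj PhiI).
rewrite (reindex (fun p : S * fconfig => (p.2, p.1))) //=.
by exists (fun p => (p.2, p.1)) => -[].
Qed.

End FiniteSites.

(** Links the cardinals in [uniform_on] to the sums over finite functions in [mass]. *)
Lemma card_fset_set_config (S : finType) n (C : set (config S n)) :
  #|` fset_set C| = #|[pred f : {ffun S * 'I_n -> bool} | `[< C f >]]|.
Proof.
pose F (f : {ffun S * 'I_n -> bool}) : config S n := f.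
have FK (x : config S n) : F [ffun c => x c] = x by apply/funext => c; rewrite /F ffunE.
have CE : C = F @` [set f : {ffun S * 'I_n -> bool} | C f].
  apply/seteqP; split=> [x Cx|_ [f Cf <-]//].
  by exists [ffun c => x c]; rewrite /= ?FK // -/(F _) FK.
have fC : finite_set C by rewrite CE; apply: finite_image; exact: finite_finset.
rewrite cardE -(size_map F); apply: perm_size; apply: uniq_perm.
- exact: fset_uniq.
- rewrite map_inj_uniq ?enum_uniq // => f g fg; apply/ffunP => c.
  exact: (congr1 (@^~ c) fg).
- move=> x; rewrite in_fset_set //; apply/idP/mapP.
    move=> /set_mem Cx; exists [ffun c => x c]; last by rewrite -/(F _) FK.
    by rewrite mem_enum inE -/(F _) FK.
  by move=> [f]; rewrite mem_enum !inE => Cf ->.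
Qed.

(** On each line the jump is the identity or an involution of the sites, so particle numbers are
    kept. *)
Lemma config_with_counts_jump n N (q : 'I_n -> nat) (x : config 'I_N n) i :
  config_with_counts N q (jump (@ordS N) (@ord_pred N) x i) <->
  config_with_counts N q x.
Proof.
suff E m : #|[set j | jump (@ordS N) (@ord_pred N) x i (j, m) == particle]%SET| =
    #|[set j | x (j, m) == particle]%SET|.
  by split=> qx m; have := qx m; rewrite /= E.
set b := bell_site (@ordS N) x i m.+1.
have [xb|xb] := boolP (x (b, m) == particle); last first.
  by apply: eq_card => j; rewrite !inE jumpE /= (negPf xb).
rewrite -[RHS](card_preimset _ (inv_inj (exchangeK (@ord_pred N) b))).
by apply: eq_card => j; rewrite !inE jumpE /= -/b xb.
Qed.

Lemma uniform_stationary (R : realType) (n N : nat) (q : 'I_n -> nat) :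
  stationary (@ordS N) (@ord_pred N) (uniform_on R (config_with_counts N q)).
Proof.
apply: stationary_of_balance; [exact: ord_predK|exact: ordSK|].
move=> L B _; exists [fset i in 'I_N]%fset; first by move=> i _; rewrite inE.
set Xq := config_with_counts N q.
pose w (x : config 'I_N n) : R := `[< Xq x >]%:R / #|` fset_set Xq|%:R.
have massE C : fine (uniform_on R Xq C) = mass w C.
  rewrite /= /mass /w -mulr_suml; congr (_ / _).
  rewrite card_fset_set_config -sum1_card natr_sum big_mkcond [RHS]big_mkcond /=.
  apply: eq_bigr => f _; rewrite inE /= asbool_and.
  by case: asboolP; case: asboolP.
under eq_bigr do rewrite !massE.
rewrite (_ : \sum_(i <- _) _ = \sum_(i : 'I_N)
  (mass w (jump_preimage (@ordS N) (@ord_pred N) i B) - mass w B)).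
  apply: sum_mass_jump; first exact: ordSK.
  move=> x i; rewrite /w; congr (_%:R / _); congr nat_of_bool.
  by apply: asbool_equiv_eq; exact: config_with_counts_jump.
apply: perm_big; apply: uniq_perm; rewrite ?fset_uniq ?index_enum_uniq //.
by move=> i; rewrite inE mem_index_enum.
Qed.

(** * Balance on the integers *)

Section Window.
Context (S' S : eqType) (succ' pred' : S' -> S') (succ pred : S -> S) (n : nat).
Hypotheses (predK' : cancel pred' succ') (succK' : cancel succ' pred')
  (predK : cancel pred succ) (succK : cancel succ pred).
Context (theta : S' -> S).
Hypothesis theta_inj : injective theta.

Definition window (x : config S n) : config S' n := fun c => x (theta c.1, c.2).

(** The hypothesis compares the reaches as ordered lists: it says that the reach of k does not cross
    the seam of the cycle, so both jumps follow the same sites. *)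
Lemma window_jump (x : config S n) k :
  map theta (reach succ' pred' n k) = reach succ pred n (theta k) ->
  window (jump succ pred x (theta k)) = jump succ' pred' (window x) k.
Proof.
move=> Hk.
have reachE l : (l <= n)%N ->
    theta (iter l succ' (pred' k)) = iter l succ (pred (theta k)).
  move=> ln; have := congr1 (fun s => nth (theta k) s l) Hk.
  rewrite -map_comp !(nth_map 0%N) ?size_map ?size_iota ?ltnS //.
  by rewrite nth_iota.
have iterE l : (l < n)%N -> theta (iter l succ' k) = iter l succ (theta k).
  by move=> ln; have := reachE l.+1 ln; rewrite !iterSr predK predK'.
have predE U (s p : U -> U) l i : cancel p s -> cancel s p ->
    p (iter l s i) = iter l s (p i).
  by move=> ps sp; rewrite -{1}(ps i) -iterSr iterS sp.
(* Line index 0 is excluded because b_0 may leave the reach, where [theta] need not commute with the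
   shifts. *)
have siteE m : (0 < m)%N -> (m <= n)%N -> exists l, [/\ (l <= n - m)%N,
    bell_site succ' (window x) k m = iter l succ' k &
    bell_site succ x (theta k) m = iter l succ (theta k)].
  move=> m0 mn; move: m0; rewrite -(subKn mn); move: (leq_subr m n).
  move: (n - m)%N; elim=> [|d ih] dn m0.
    by exists 0%N; rewrite subn0 !bell_site_bottom.
  have ltdn : (n - d.+1 < n)%N by rewrite ltn_subrL (leq_trans _ dn).
  have [|l [ld Ek Ex]] := ih (ltnW dn); first by rewrite subn_gt0.
  rewrite -[(n - d.+1)%N]/(nat_of_ord (Ordinal ltdn)) !bell_site_rec /=.
  rewrite -subSn // subSS Ek Ex {1}/window /=.
  have lE : theta (iter l succ' k) = iter l succ (theta k).
    by apply: iterE; lia.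
  rewrite -lE; move: ld; rewrite !subKn // ?(ltnW dn) // => ld.
  case: ifP => _; [exists l|exists l.+1]; split=> //; first exact: leqW.
  by rewrite iterS lE.
apply/funext => -[j m]; rewrite {1}/window /jump /=.
have [l [ln -> ->]] := siteE m.+1 isT (ltn_ord m).
have ltn1 : (l < n)%N by have := ltn_ord m; lia.
have lE := iterE l ltn1.
have plE : theta (pred' (iter l succ' k)) = pred (iter l succ (theta k)).
  by rewrite (predE _ succ') // (predE _ succ) // reachE // ltnW.
by rewrite -plE -lE /window /= !(inj_eq theta_inj).
Qed.

End Window.

Section ProductWeight.
Context (R : realType) (n : nat) (rho : 'I_n -> R).

Definition site_weight (m : 'I_n) (v : bool) : R :=
  if v == particle then rho m else 1 - rho m.

Definition product_weight (S : finType) (x : config S n) : R :=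
  \prod_(c : S * 'I_n) site_weight c.2 (x c).

(** A jump permutes the values within a line, and the weight of a value depends only on its line. *)
Lemma product_weight_jump (S : finType) (succ pred : S -> S) (x : config S n) i :
  product_weight (jump succ pred x i) = product_weight x.
Proof.
rewrite /product_weight.
have E (y : config S n) : \prod_(c : S * 'I_n) site_weight c.2 (y c) =
    \prod_(m : 'I_n) \prod_(j : S) site_weight m (y (j, m)).
  by rewrite exchange_big pair_big /=; apply: eq_bigr => -[].
rewrite !E; apply: eq_bigr => m _.
set b := bell_site succ x i m.+1.
have [xb|xb] := boolP (x (b, m) == particle); last first.
  by apply: eq_bigr => j _; rewrite jumpE /= -/b (negPf xb).
rewrite [RHS](reindex_inj (inv_inj (exchangeK pred b))).
by apply: eq_bigr => j _; rewrite jumpE /= -/b xb.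
Qed.

(** The event is a finite disjoint union of cells prescribing the whole window, and independence
    gives each cell its product weight. *)
Lemma product_distribution_window (S' : finType) (S : choiceType)
    (theta : S' -> S) (nu : probability (config S n) R) (C : set (config S' n)) :
  injective theta -> product_distribution rho nu ->
  fine (nu (window (n := n) theta @^-1` C)) = mass (@product_weight S') C.
Proof.
move=> theta_inj [nu1 nuP].
have nu_site c v : nu [set x | x c = v] = (site_weight c.2 v)%:E.
  case: c => i m; rewrite /site_weight /particle /=.
  case: v; last exact: nu1.
  rewrite (_ : [set x | _] = ~` [set x | x (i, m) = particle]).
    rewrite probability_setC; last exact: measurable_cylinder.
    by rewrite nu1 -EFinB.
  by apply/seteqP; split=> x /=; rewrite /particle; case: (x (i, m)).
pose h (c : S' * 'I_n) := (theta c.1, c.2).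
have h_inj : injective h by move=> [j m] [j' m'] [/theta_inj -> ->].
pose cell (f : {ffun S' * 'I_n -> bool}) : set (config S n) :=
  [set x | forall c, x (h c) = f c].
have nu_cell f : nu (cell f) = (product_weight (f : config S' n))%:E.
  pose A := [fset c in map h (enum {: S' * 'I_n})]%fset.
  (* Prescribes f c at h c, and imposes nothing off the range of h. *)
  pose Bf c' := [set v | forall c, h c = c' -> v = f c].
  have -> : cell f = \bigcap_(c in [set` A]) [set x | Bf c (x c)].
    apply/seteqP; split=> x /=.
      by move=> xf c' _ c <-; exact: xf.
    move=> xf c; apply: (xf (h c)) => //=.
    by rewrite inE; apply: map_f; rewrite mem_enum.
  rewrite nuP (perm_big (map h (enum {: S' * 'I_n}))); last first.
    apply: uniq_perm => [||c]; [exact: fset_uniq| |by rewrite inE].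
    by rewrite map_inj_uniq // enum_uniq.
  rewrite big_map big_enum /= /product_weight -prodEFin.
  apply: eq_bigr => c _; rewrite -(nu_site (h c)); congr (nu _).
  apply/seteqP; split=> x /=; first by move=> /(_ c erefl).
  by move=> xc c' /h_inj ->.
have mcell f : measurable (cell f).
  apply: (@measurable_finitely_determined _ _ (map h (enum {: S' * 'I_n}))).
  by move=> x y xy xf c; rewrite -xy ?xf // map_f // mem_enum.
have -> : window theta @^-1` C = \bigcup_(f in [set` enum [pred f : {ffun S' * 'I_n -> bool} | `[< C f >]]]) cell f.
  apply/seteqP; split=> x /=.
    move=> Cx; exists [ffun c => x (h c)]; last by move=> c; rewrite ffunE.
    rewrite /= mem_enum inE; congr C: Cx; apply/funext => c; by rewrite ffunE.
  move=> [f /=]; rewrite mem_enum inE => Cf xf; congr C: Cf.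
  by apply/funext => c; rewrite -xf.
rewrite measure_fin_bigcup //.
- rewrite -fsbig_seq ?enum_uniq // big_enum /=.
  by under eq_bigr do rewrite nu_cell; rewrite sumEFin.
- move=> f g _ _ [x [xf xg]]; apply/ffunP => c; by rewrite -xf xg.
Qed.

End ProductWeight.

Lemma iter_addz1 (a : int) (l : nat) : iter l (fun i : int => i + 1) a = a + l%:Z.
Proof. elim: l => [|l ih] /=; [lia|rewrite ih; lia]. Qed.

Lemma iter_subz1 (a : int) (l : nat) : iter l (fun i : int => i - 1) a = a - l%:Z.
Proof. elim: l => [|l ih] /=; [lia|rewrite ih; lia]. Qed.

Lemma val_ord_pred (N : nat) (k : 'I_N) : (0 < k)%N -> ord_pred k = k.-1 :> nat.
Proof.
move=> k0 /=; have kN := ltn_ord k.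
have -> : ((k + N).-1 = k.-1 + N)%N by lia.
by rewrite modnDr modn_small //; lia.
Qed.

Lemma val_iter_ordS (N : nat) (k : 'I_N) (l : nat) : (k + l < N)%N ->
  iter l (@ordS N) k = (k + l)%N :> nat.
Proof.
elim: l => [|l ih] klN; first by rewrite addn0.
by rewrite iterS /= ih ?modn_small; lia.
Qed.

Lemma val_iter_ord_pred (N : nat) (k : 'I_N) (l : nat) : (l <= k)%N ->
  iter l (@ord_pred N) k = (k - l)%N :> nat.
Proof.
elim: l => [|l ih] lk; first by rewrite subn0.
by rewrite iterS val_ord_pred ih; lia.
Qed.

Lemma product_balance (R : realType) (n : nat) (rho : 'I_n -> R)
    (nu : probability (config int n) R) (L : seq int) (B : set (config int n)) :
  product_distribution rho nu -> supported L B ->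
  exists2 A : {fset int},
    {subset bells (fun i : int => i + 1) (fun i : int => i - 1) n L <= A} &
    \sum_(i <- A) (fine (nu (jump_preimage (fun i : int => i + 1)
        (fun i : int => i - 1) i B)) - fine (nu B)) = 0.
Proof.
set succ := fun i : int => i + 1; set pred := fun i : int => i - 1.
have predK : cancel pred succ by move=> i; rewrite /pred /succ; lia.
have succK : cancel succ pred by move=> i; rewrite /pred /succ; lia.
move=> nuP sB.
pose M := \max_(j <- L) `|j|%N.
have LM j : j \in L -> (`|j| <= M)%N.
  by move=> jL; exact: (@leq_bigmax_seq _ L xpredT (fun j : int => `|j|%N) j).
(* The window runs from -(M + n + 1) to M + n + 2. The bells of L have their reaches within -(M +
   n), ..., M + n, away from the seam. *)
pose N := (2 * M + 2 * n + 3).+1; pose u : int := - (M + n + 1)%N%:Z.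
pose theta (k : 'I_N) : int := u + k%:Z.
have theta_inj : injective theta.
  by move=> k k'; rewrite /theta => E; apply: val_inj => /=; lia.
have thetaK i : u <= i -> i < u + N%:Z -> theta (inord `|i - u|%N) = i.
  by move=> ui iu; rewrite /theta inordK; rewrite /N in iu *; lia.
pose A := [fset i in map theta (enum 'I_N)]%fset.
have memA k : theta k \in A by rewrite inE map_f // mem_enum.
have bellsP i : i \in bells succ pred n L ->
    exists k : 'I_N, [/\ theta k = i, (0 < k)%N & (k + n <= N)%N].
  case/allpairsP => -[j l] [/LM jM]; rewrite mem_iota add0n ltnS /= iter_subz1 => ln.
  rewrite /= in jM; rewrite /succ => ->; set i' : int := _ + 1.
  have lo : u + 1 <= i' by rewrite /u /i'; lia.
  have hi : i' + n%:Z <= u + N%:Z by rewrite /u /N /i'; lia.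
  have aE : (`|i' - u|%N)%:Z = i' - u by lia.
  have aN : (`|i' - u| < N)%N by lia.
  by exists (inord `|i' - u|%N); rewrite thetaK ?inordK //; try lia; split=> //; lia.
exists A; first by move=> i /bellsP[k [<- _ _]].
have thetaL j : j \in L -> theta (inord `|j - u|%N) = j.
  move=> /LM /= jM; apply: thetaK; first by rewrite /u; lia.
  by rewrite /u /N; lia.
(* Sites outside the window read arbitrary values of y; B does not see them, L being inside. *)
pose B' : set (config 'I_N n) :=
  [set y | B (fun c => y (inord `|c.1 - u|%N, c.2))].
have B'E x : B x <-> B' (window theta x).
  by apply: (supportedP sB) => j m jL; rewrite /window /= thetaL.
pose L' := [seq k <- enum 'I_N | theta k \in L].
have sB' : supported L' B'.
  move=> y y' yy'; apply: sB => j m jL; apply: yy'.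
  by rewrite mem_filter mem_enum thetaL ?jL.
(* Sites of L' are at least n + 1 steps from the left end, so no bell of L' comes from wrapping
   around. *)
have outside k : theta k \notin bells succ pred n L ->
    k \notin bells (@ordS N) (@ord_pred N) n L'.
  apply: contra => /allpairsP[[k' l] []].
  rewrite mem_filter mem_iota add0n ltnS /= => /andP[kL _] ln kE.
  apply/allpairsP; exists (theta k', l); rewrite mem_iota add0n ltnS; split=> //=.
  have kM := LM _ kL; have ltk := ltn_ord k'.
  rewrite iter_subz1 /succ kE /theta /=.
  rewrite val_iter_ord_pred ?modn_small; rewrite /theta /N /u in kM ltk *; lia.
have window_preimage k : theta k \in bells succ pred n L ->
    jump_preimage succ pred (theta k) B =
    window theta @^-1` jump_preimage (@ordS N) (@ord_pred N) k B'.
  move=> /bellsP[k' [/theta_inj -> k0 kn]].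
  apply/funext => x; apply/propext.
  rewrite /jump_preimage /= -(@window_jump _ _ _ _ succ pred) //.
  - exact: ord_predK.
  - exact: ordSK.
  rewrite -map_comp; apply/eq_in_map => l; rewrite mem_iota add0n ltnS => /= ln.
  rewrite iter_addz1 /theta /pred val_iter_ordS val_ord_pred //; last lia.
  lia.
have nu_window C C' : C = window theta @^-1` C' ->
    fine (nu C) = mass (@product_weight R n rho 'I_N) C'.
  by move=> ->; exact: product_distribution_window.
have nuB : fine (nu B) = mass (@product_weight R n rho 'I_N) B'.
  by apply: nu_window; apply/funext => x; apply/propext; exact: B'E.
rewrite (perm_big (map theta (enum 'I_N))); last first.
  apply: uniq_perm => [||i]; [exact: fset_uniq| |by rewrite inE].
  by rewrite map_inj_uniq // enum_uniq.
rewrite big_map big_enum /= -[RHS](@sum_mass_jump R 'I_N (@ordS N) (@ord_pred N)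
  n (@ordSK N) (@product_weight R n rho 'I_N) B'); last first.
  by move=> x i; exact: product_weight_jump.
(* The sums agree term by term: bells of L are compared through the window, and all other terms
   vanish on both sides. *)
apply: eq_bigr => k _; have [kL|kL] := boolP (theta k \in bells succ pred n L).
  by rewrite (nu_window _ _ (window_preimage k kL)) nuB.
rewrite (jump_preimage_disjoint predK succK sB kL).
rewrite (jump_preimage_disjoint (@ord_predK N) (@ordSK N) sB' (outside k kL)).
by rewrite !subrr.
Qed.

Lemma product_stationary (R : realType) (n : nat) (rho : 'I_n -> R)
    (nu : probability (config int n) R) : product_distribution rho nu ->
  stationary (fun i : int => i + 1) (fun i : int => i - 1) nu.
Proof.
move=> nuP; apply: stationary_of_balance => [i|i|L B]; [lia|lia|].
exact: product_balance nuP.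
Qed.

Theorem theorem3p1 (R : realType) (n : nat) (n_ge1 : (1 <= n)%N) :
  (forall (N : nat) (q : 'I_n -> nat),
     (1 <= N)%N -> (forall m, (q m <= N)%N) ->
     stationary (@ordS N) (@ord_pred N)
       (uniform_on R (config_with_counts N q)))
  /\
  (forall rho : 'I_n -> R, (forall m, 0 <= rho m <= 1) ->
     forall nu : probability (config int n) R,
       product_distribution rho nu ->
       stationary (fun i : int => i + 1) (fun i : int => i - 1) nu).
Proof.
split=> [N q _ _|rho _ nu]; first exact: uniform_stationary.
exact: product_stationary.
Qed.
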